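(* Let $a\ge2$ be an even integer. The subtraction set of the subtraction game $\mathcal{S}(1,a,a+1)$ has expansion $\big(\{1,3,\ldots,a-1\}\cup\{a\}\cup\{a+1,a+3,\ldots,2a-1\}\big)^{*(2a)}$.
   Context: For a finite set $S$ of positive integers, the subtraction game $\mathcal{S}(S)$ is played on a single pile: two players alternately remove $s\in S$ coins (at most the pile size); the last mover wins. The nim-value is $\mathcal{G}(n)=\operatorname{mex}\{\mathcal{G}(n-s): s\in S, s\le n\}$. The expansion of $S$ is $S^{ex}=\{s\ge1:\mathcal{G}(n+s)\ne\mathcal{G}(n)\ \forall n\ge0\}$; ''has expansion $T$'' means $S^{ex}=T$. For a set $X$ and $p\ge1$, $X^{*p}=\{x+mp:x\in X,m\ge0\}$. *)

(* Defs.v *)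
From mathcomp Require Import all_boot finmap classical_sets.

Set Implicit Arguments.
Unset Strict Implicit.
Unset Printing Implicit Defensive.

Local Open Scope nat_scope.
Local Open Scope classical_set_scope.

Lemma mex_exists (X : seq nat) : exists n, n \notin X.
Proof.
exists (\max_(x <- X) x).+1; apply/negP => /(@leq_bigmax_seq _ X xpredT id).
by move=> /(_ isT); rewrite ltnn.
Qed.

Definition mex (X : seq nat) : nat := ex_minn (mex_exists X).

(* The recursion of the nim-values, with a bound k on the recursion depth. *)
Fixpoint nim_rec (S : {fset nat}) (k n : nat) : nat :=
  if k is k'.+1 then mex [seq nim_rec S k' (n - s) | s <- S & s <= n] else 0.

(* Depth n.+1 suffices when all moves are positive, see [nim_valueE]. *)
Definition nim_value (S : {fset nat}) (n : nat) : nat := nim_rec S n.+1 n.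

Lemma nim_rec_stable (S : {fset nat}) (k n : nat) :
  0 \notin S -> n < k -> nim_rec S k n = nim_value S n.
Proof.
move=> S0; rewrite /nim_value.
suff H m l : n < m -> n < l -> nim_rec S m n = nim_rec S l n by move/H; apply.
elim: m l n => [|m IH] [|l] n //= nm nl; congr mex.
apply/eq_in_map => s; rewrite mem_filter => /andP[sn sS].
have s0 : 0 < s by rewrite lt0n; apply: contraNneq S0 => <-.
have ltn : n - s < n by rewrite ltn_subrL s0 (leq_trans s0 sn).
by apply: IH; exact: leq_trans ltn _.
Qed.

Lemma nim_valueE (S : {fset nat}) (n : nat) : 0 \notin S ->
  nim_value S n = mex [seq nim_value S (n - s) | s <- S & s <= n].
Proof.
move=> S0; rewrite {1}/nim_value /=; congr mex.
apply/eq_in_map => s; rewrite mem_filter => /andP[sn sS].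
have s0 : 0 < s by rewrite lt0n; apply: contraNneq S0 => <-.
by apply: nim_rec_stable => //; rewrite ltn_subrL s0 (leq_trans s0 sn).
Qed.

Definition expansion (S : {fset nat}) : set nat :=
  [set s | 1 <= s /\ forall n, nim_value S (n + s) <> nim_value S n].

(* X^{*p} *)
Definition star (X : set nat) (p : nat) : set nat :=
  [set y | exists x m, X x /\ y = x + m * p].

(* {l, l + 2, l + 4, ..., h} *)
Definition step2 (l h : nat) : set nat :=
  [set k | exists j, k = l + 2 * j /\ k <= h].

(* Main.v *)
Require Import Defs.
From mathcomp Require Import all_boot finmap classical_sets.
From mathcomp Require Import zify.

(** The nim-values are purely periodic with period [2 * a]: writing
    [n = k * a + r] with [r < a], one has [G n = n mod 2 + 2 * (k mod 2)].
    Hence [G (n + s)] and [G n] always differ when [s] is odd (parity) or when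
    [s] is an odd multiple of [a] (the parity of [k] flips).  Any other even
    [s = k * a + r] fails: at [n = 0] if [k] is even, and at [n = a - r] if [k]
    is odd and [r > 0], all the values involved being [0]. *)

Local Open Scope nat_scope.
Local Open Scope classical_set_scope.

Lemma mex_eq (X : seq nat) (v : nat) :
  v \notin X -> (forall w, w < v -> w \in X) -> mex X = v.
Proof.
move=> vX ltX; rewrite /mex; case: ex_minnP => m mX min_m.
apply/eqP; rewrite eqn_leq min_m //= leqNgt.
by apply: contraNN mX => /ltX.
Qed.

Definition nim_closed (a n : nat) : nat := odd n + 2 * odd (n %/ a).

Lemma nim_closedE (a k r : nat) :
  ~~ odd a -> r < a -> nim_closed a (k * a + r) = odd r + 2 * odd k.
Proof.
move=> a_even ra; rewrite /nim_closed divnMDl ?(leq_ltn_trans _ ra) //.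
by rewrite divn_small // addn0 oddD oddM (negbTE a_even) andbF.
Qed.

Lemma nim_closed_odd_shift (a n s : nat) :
  odd s -> nim_closed a (n + s) <> nim_closed a n.
Proof. by rewrite /nim_closed oddD => ->; lia. Qed.

(** The quotient by [a] grows by exactly [k], so the high bit flips, whatever the low bit does. *)
Lemma nim_closed_odd_mul_shift (a n k : nat) : 0 < a -> odd k ->
  nim_closed a (n + k * a) <> nim_closed a n.
Proof.
move=> a0 k_odd; rewrite /nim_closed (addnC n) divnMDl // !oddD k_odd.
by case: (odd n) (odd (k * a)) (odd (n %/ a)) => [] [] [].
Qed.

(** Strong induction on [n]. The two shift lemmas, applied at [n - s], show that no option has the
    claimed value; every smaller value [w] is reached by an explicit move. *)
Lemma nim_value_closed (a n : nat) : 2 <= a -> ~~ odd a ->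
  nim_value [fset 1; a; (a + 1)%N]%fset n = nim_closed a n.
Proof.
move=> ha a_even; elim/ltn_ind: n => n IH.
have a0 : 0 < a by lia.
have S0 : 0 \notin [fset 1; a; (a + 1)%N]%fset by rewrite !inE; lia.
rewrite nim_valueE //.
have -> : [seq nim_value [fset 1; a; (a + 1)%N]%fset (n - s)
            | s <- [fset 1; a; (a + 1)%N]%fset & s <= n] =
          [seq nim_closed a (n - s)
            | s <- [fset 1; a; (a + 1)%N]%fset & s <= n].
  apply/eq_in_map => s; rewrite mem_filter !inE => /andP[sn sS].
  by apply: IH; lia.
apply: mex_eq.
  apply/negP => /mapP[s]; rewrite mem_filter !inE => /andP[sn sS].
  rewrite -{1}(subnK sn); case/orP: sS => [/orP[]|] /eqP ->.
  - exact: nim_closed_odd_shift.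
  - by rewrite -{3}[a]mul1n; apply: nim_closed_odd_mul_shift.
  - by apply: nim_closed_odd_shift; rewrite addn1.
have ra := ltn_pmod n a0.
move=> w; rewrite (divn_eq n a); set k := n %/ a; move: (n %% a) ra => r ra.
rewrite nim_closedE // => wlt.
(* To reach [w], it suffices to find a move [s] landing at offset [t] of block [q] with these two
   bits. *)
have option s q t : s \in [fset 1; a; (a + 1)%N]%fset -> t < a ->
    k * a + r = q * a + t + s -> odd t + 2 * odd q = w ->
    w \in [seq nim_closed a (k * a + r - s)
            | s <- [fset 1; a; (a + 1)%N]%fset & s <= k * a + r].
  move=> sS ta -> <-; apply/mapP; exists s.
    by rewrite mem_filter leq_addl.
  by rewrite addnK nim_closedE.
(* For even [k], [w < odd r] forces [w = 0] and [r] odd: removing 1 stays in the block. *)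
have [k_odd|k_even] := boolP (odd k); last first.
  by apply: (option 1 k r.-1); rewrite ?inE //; lia.
have kE : k * a = k.-1 * a + a by rewrite -mulSnr prednK //; lia.
have [w2|w2] := eqVneq w 2.
  by apply: (option 1 k r.-1); rewrite ?inE //; lia.
(* Now [w] is 0 or 1, so the move must end in block [k.-1]. Removing [a] keeps the offset and hence
   the low bit. *)
have [wr|wr] := eqVneq w (odd r : nat).
  by apply: (option a k.-1 r); rewrite ?inE ?eqxx ?orbT //; lia.
(* The low bit must flip. From offset 0, removing 1 reaches the last offset [a.-1] of the previous
   block, odd as [a] is even; otherwise [a + 1] lowers the offset by one. *)
have [r0|r0] := eqVneq r 0.
  by apply: (option 1 k.-1 a.-1); rewrite ?inE //; lia.
by apply: (option (a + 1) k.-1 r.-1); rewrite ?inE ?eqxx ?orbT //; lia.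
Qed.

Lemma expansionP (a s : nat) : 2 <= a -> ~~ odd a ->
  expansion [fset 1; a; (a + 1)%N]%fset s <->
  odd s \/ exists m, s = a + m * (2 * a).
Proof.
move=> ha a_even; have a0 : 0 < a by lia.
split=> [[_ neq]|sP]; last first.
  split; first by case: sP => [|[m]]; lia.
  move=> n; rewrite !nim_value_closed //.
  case: sP => [/nim_closed_odd_shift|[m ->]]; first exact.
  have -> : a + m * (2 * a) = (m.*2).+1 * a by lia.
  by apply: nim_closed_odd_mul_shift => //=; rewrite odd_double.
have neqG n : nim_closed a (n + s) <> nim_closed a n.
  by rewrite -!nim_value_closed.
have [s_odd|s_even] := boolP (odd s); [by left|right].
have ra := ltn_pmod s a0.
move: neqG s_even; rewrite (divn_eq s a); move: (s %/ a) (s %% a) ra => k r ra.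
move=> neqG; rewrite oddD oddM (negbTE a_even) andbF /= => r_even.
have G0 t : t < a -> ~~ odd t -> nim_closed a t = 0.
  by move=> ta t_even; rewrite -[t]/(0 * a + t) nim_closedE //; lia.
have [k_odd|k_even] := boolP (odd k); last first.
  by have := neqG 0; rewrite add0n nim_closedE // G0 //; lia.
have [->|r0] := eqVneq r 0.
  by exists k./2; rewrite -{1}(odd_double_half k) k_odd; lia.
(* Adding the even number [a - r] completes [s] to an even multiple of [a], of value 0. *)
have := neqG (a - r).
have -> : a - r + (k * a + r) = k.+1 * a + 0 by lia.
by rewrite nim_closedE // G0 /=; lia.
Qed.

(** Reduction modulo the even number [2 * a] preserves parity, and the two progressions list the odd
    residues below and above [a]. *)
Lemma starP (a s : nat) : 0 < a -> ~~ odd a ->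
  star (step2 1 (a - 1) `|` [set a] `|` step2 (a + 1) (2 * a - 1)) (2 * a) s <->
  odd s \/ exists m, s = a + m * (2 * a).
Proof.
move=> a0 a_even; split=> [[x [m [xX ->]]]|].
  case: xX => [[[j [-> _]]| ->]|[j [-> _]]]; [left|right|left]; try lia.
  by exists m.
case=> [s_odd|[m ->]]; last by exists a, m; split=> //; left; right.
have ra : s %% (2 * a) < 2 * a by rewrite ltn_pmod //; lia.
have sE := divn_eq s (2 * a).
exists (s %% (2 * a)), (s %/ (2 * a)); split; last by rewrite {1}sE addnC.
have : odd (s %% (2 * a)) by move: s_odd; rewrite {1}sE; lia.
move: (s %% (2 * a)) ra => r ra r_odd.
have [ltra|lear] := ltnP r a.
  by left; left; exists r./2; lia.
by right; exists (r - a)./2; lia.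
Qed.

Theorem theorem3p4 (a : nat) (ha : 2 <= a) (a_even : ~~ odd a) :
  expansion [fset 1; a; (a + 1)%N]%fset =
  star (step2 1 (a - 1) `|` [set a] `|` step2 (a + 1) (2 * a - 1)) (2 * a).
Proof.
apply/seteqP; split=> s.
  by move/expansionP => /(_ ha a_even)/starP; apply=> //; exact: ltnW.
by move/starP => /(_ (ltnW ha) a_even)/expansionP; apply.
Qed.
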